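(* Let $C_4$ be the cycle on 4 vertices. Then $W[C_4]=W^*[C_4]=4$.
   Context: Graphs are finite, simple, undirected, loopless. First-order sentences about graphs use only adjacency $\sim$ and equality $=$. Write $F\sqsubset G$ if $G$ contains an induced copy of $F$. $W[F]$ is the minimum number of distinct variables in a first-order sentence $\Phi$ with $G\models\Phi$ iff $F\sqsubset G$ for all graphs $G$. For non-isomorphic $G,H$, $W(G,H)$ is the minimum number of distinct variables in a sentence true on one and false on the other; $W^*[F]=\max\{W(G,H):F\sqsubset G,\ F\not\sqsubset H\}$. *)

(* Defs.v *)
From HB Require Import structures.
From mathcomp Require Import all_boot.
Set Implicit Arguments.
Unset Strict Implicit.
Unset Printing Implicit Defensive.

(* The graph with no vertices is allowed. *)
Record sgraph := SGraph {
  vertex :> finType;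
  adj : rel vertex;
  adj_sym : symmetric adj;
  adj_irr : irreflexive adj
}.

Arguments adj {G} : rename.

Definition induced_in (F G : sgraph) : Prop :=
  exists f : F -> G,
    injective f /\ (forall x y : F, adj (f x) (f y) = adj x y).

Notation "F ⊏ G" := (induced_in F G) (at level 70, no associativity).

Inductive formula : Type :=
  | FAdj (x y : nat)
  | FEq (x y : nat)
  | FNot (p : formula)
  | FAnd (p q : formula)
  | FOr (p q : formula)
  | FEx (x : nat) (p : formula)
  | FAll (x : nat) (p : formula).

(* Bound occurrences, including the variable next to a quantifier, count. *)
Fixpoint vars (p : formula) : seq nat :=
  match p with
  | FAdj x y | FEq x y => [:: x; y]
  | FNot p => vars p
  | FAnd p q | FOr p q => vars p ++ vars q
  | FEx x p | FAll x p => x :: vars p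
  end.

Definition nvars (p : formula) : nat := size (undup (vars p)).

Fixpoint free_vars (p : formula) : seq nat :=
  match p with
  | FAdj x y | FEq x y => [:: x; y]
  | FNot p => free_vars p
  | FAnd p q | FOr p q => free_vars p ++ free_vars q
  | FEx x p | FAll x p => [seq y <- free_vars p | y != x]
  end.

Definition sentence (p : formula) : bool := nilp (free_vars p).

Definition upd (T : Type) (e : nat -> option T) (x : nat) (v : T) :
    nat -> option T :=
  fun y => if y == x then Some v else e y.

(* Assignments are partial so that sentences also have a truth value in the
   graph with no vertices. An atom with an unassigned variable is false; this
   never happens when a sentence is evaluated from the empty assignment. *)
Fixpoint eval (G : sgraph) (e : nat -> option G) (p : formula) : bool :=
  match p with
  | FAdj x y => if (e x, e y) is (Some u, Some v) then adj u v else false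
  | FEq x y => if (e x, e y) is (Some u, Some v) then u == v else false
  | FNot p => ~~ eval e p
  | FAnd p q => eval e p && eval e q
  | FOr p q => eval e p || eval e q
  | FEx x p => [exists v : G, eval (upd e x v) p]
  | FAll x p => [forall v : G, eval (upd e x v) p]
  end.

Definition models (G : sgraph) (p : formula) : bool :=
  eval (fun _ => None : option G) p.

Notation "G ⊨ p" := (models G p) (at level 70, no associativity).

Definition is_min (S : nat -> Prop) (n : nat) : Prop :=
  S n /\ (forall m, S m -> n <= m).

Definition is_max (S : nat -> Prop) (n : nat) : Prop :=
  S n /\ (forall m, S m -> m <= n).

(* W[F] = n *)
Definition W_eq (F : sgraph) (n : nat) : Prop :=
  is_min (fun k => exists p : formula,
    [/\ sentence p, nvars p = k & forall G : sgraph, G ⊨ p <-> F ⊏ G]) n.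

(* W(G,H) = n. No n qualifies when G and H are isomorphic. *)
Definition Wpair_eq (G H : sgraph) (n : nat) : Prop :=
  is_min (fun k => exists p : formula,
    [/\ sentence p, nvars p = k & (G ⊨ p) != (H ⊨ p)]) n.

(* W^*[F] = n. Graphs G and H as below are not isomorphic, so W(G,H) exists. *)
Definition Wstar_eq (F : sgraph) (n : nat) : Prop :=
  is_max (fun k => exists G H : sgraph,
    [/\ F ⊏ G, ~ F ⊏ H & Wpair_eq G H k]) n.

Definition C4_adj : rel 'I_4 := fun i j => (ordS i == j) || (ordS j == i).

Lemma C4_adj_sym : symmetric C4_adj.
Proof. by move=> i j; rewrite /C4_adj orbC. Qed.

Lemma C4_adj_irr : irreflexive C4_adj.
Proof. by case=> [[|[|[|[|]]]]]. Qed.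

Definition C4 : sgraph := SGraph C4_adj_sym C4_adj_irr.

(* Main.v *)
Require Import Defs.
From HB Require Import structures.
From mathcomp Require Import all_boot.
Set Implicit Arguments.
Unset Strict Implicit.
Unset Printing Implicit Defensive.

(** An induced 4-cycle is described by naming its four vertices, which gives both
upper bounds. For the lower bounds, call a graph rich if every pair of vertices
[u, v] has a further vertex realizing each adjacency pattern to [u] and [v] that
creates no triangle. In the 3-pebble game on two rich triangle-free graphs
Duplicator always has an answer, so no sentence with three variables separates
them. The Wagner graph (the 8-cycle with its four long diagonals) and the Petersen
graph are both rich and triangle-free; the first contains an induced 4-cycle,
while the second has girth 5. *)

(** * The 3-pebble game *)

(** Atoms mention at most two variables, so a partial isomorphism can be checked on pairs of
    pebbles. *)
Definition same_pair (G H : sgraph) (u v : G) (u' v' : H) : Prop :=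
  (u == v) = (u' == v') /\ adj u v = adj u' v'.

Lemma same_pair_sym (G H : sgraph) (u v : G) (u' v' : H) :
  same_pair u v u' v' -> same_pair v u v' u'.
Proof.
by case=> h1 h2; split; [rewrite eq_sym h1 eq_sym | rewrite adj_sym h2 adj_sym].
Qed.

Lemma same_pair_refl (G H : sgraph) (u : G) (u' : H) : same_pair u u u' u'.
Proof. by split; rewrite ?eqxx ?adj_irr. Qed.

(** One round of the game: two pebbles stay in place, Spoiler puts the third on [w] and Duplicator
    answers [w']. *)
Definition extends (G H : sgraph) : Prop :=
  forall (u v : G) (u' v' : H), same_pair u v u' v' ->
  forall w : G, exists w' : H, same_pair u w u' w' /\ same_pair v w v' w'.

(** A position that Duplicator has not lost. The pebbles are the variables in [V]; an unassigned
    variable is a pebble off the board. *)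
Definition agree (G H : sgraph) (e : nat -> option G) (e' : nat -> option H)
    (V : seq nat) : Prop :=
  {in V, forall x, isSome (e x) = isSome (e' x)} /\
  {in V &, forall x y u v u' v', e x = Some u -> e y = Some v ->
     e' x = Some u' -> e' y = Some v' -> same_pair u v u' v'}.

Lemma agree_sym (G H : sgraph) (e : nat -> option G) (e' : nat -> option H) V :
  agree e e' V -> agree e' e V.
Proof.
case=> h1 h2; split=> [x xV | x y xV yV u v u' v' *]; first by rewrite h1.
by case: (h2 x y xV yV u' v' u v).
Qed.

Lemma agree_extension (G H : sgraph) (e : nat -> option G) (e' : nat -> option H)
    (s : seq nat) (w : G) :
  extends G H -> inhabited H -> size s <= 2 -> agree e e' s ->
  exists w' : H, {in s, forall y u u', e y = Some u -> e' y = Some u' ->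
    same_pair u w u' w'}.
Proof.
move=> ext [h0] ss [dom pairs].
have ext1 y : y \in s -> exists w' : H, forall u u', e y = Some u ->
    e' y = Some u' -> same_pair u w u' w'.
  move=> ys; case ey: (e y) => [u|]; last by exists h0.
  case ey': (e' y) => [u'|]; last by exists h0.
  (* A single pebble on the board is treated as a doubled one. *)
  have [w' [hw' _]] := ext u u u' u' (same_pair_refl u u') w.
  by exists w' => _ _ [<-] [<-].
case: s ss dom pairs ext1 => [|y [|z [|//]]] _ dom pairs ext1.
- by exists h0.
- have [w' hw'] := ext1 y (mem_head _ _); exists w' => t.
  by rewrite inE => /eqP ->.
have ys : y \in [:: y; z] by rewrite !inE eqxx.
have zs : z \in [:: y; z] by rewrite !inE eqxx orbT.
case ey: (e y) => [u|]; last first.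
  have [w' hw'] := ext1 z zs; exists w' => t.
  by rewrite !inE => /orP[] /eqP -> //; rewrite ey.
case ez: (e z) => [v|]; last first.
  have [w' hw'] := ext1 y ys; exists w' => t.
  by rewrite !inE => /orP[] /eqP -> //; rewrite ez.
have := dom y ys; rewrite ey; case ey': (e' y) => [u'|] // _.
have := dom z zs; rewrite ez; case ez': (e' z) => [v'|] // _.
have [w' [h1 h2]] := ext _ _ _ _ (pairs y z ys zs _ _ _ _ ey ez ey' ez') w.
exists w' => t; rewrite !inE => /orP[] /eqP -> a a'.
- by rewrite ey ey' => -[<-] [<-].
- by rewrite ez ez' => -[<-] [<-].
Qed.

(** Moving the pebble [x] leaves at most two others in place, those of [rem x V], so
    [agree_extension] supplies the answer. *)
Lemma agree_upd (G H : sgraph) (e : nat -> option G) (e' : nat -> option H)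
    (V : seq nat) (x : nat) (w : G) :
  extends G H -> inhabited H -> uniq V -> size V <= 3 -> x \in V ->
  agree e e' V -> exists w' : H, agree (upd e x w) (upd e' x w') V.
Proof.
move=> ext h0 uV sV xV [dom pairs].
have ss : size (rem x V) <= 2 by rewrite size_rem //; case: (size V) sV.
have sub : {subset rem x V <= V} := @mem_rem _ x V.
have agr : agree e e' (rem x V).
  by split=> [y /sub | y z /sub yV /sub zV]; [exact: dom | exact: pairs].
have [w' hw'] := agree_extension w ext h0 ss agr.
have inrem y : y \in V -> y != x -> y \in rem x V.
  by rewrite mem_rem_uniq // inE => -> ->.
exists w'; split=> [y yV | y z yV zV u v u' v'].
  by rewrite /upd; case: eqP => // _; exact: dom.
rewrite /upd; case: (eqVneq y x) => yx; case: (eqVneq z x) => zx.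
- by move=> [<-] [<-] [<-] [<-]; exact: same_pair_refl.
- move=> [<-] ez [<-] ez'; apply: same_pair_sym.
  exact: hw' (inrem z zV zx) _ _ ez ez'.
- by move=> ey [<-] ey' [<-]; exact: hw' (inrem y yV yx) _ _ ey ey'.
- exact: pairs.
Qed.

(** Induction on [p] with [V] fixed. A quantifier is one round; the two directions of its
    equivalence need answers in both graphs, hence the symmetric hypotheses. *)
Lemma eval_agree (G H : sgraph) (V : seq nat) :
  extends G H -> extends H G -> inhabited G -> inhabited H ->
  uniq V -> size V <= 3 ->
  forall (p : formula) (e : nat -> option G) (e' : nat -> option H),
  {subset vars p <= V} -> agree e e' V -> eval e p = eval e' p.
Proof.
move=> extGH extHG g0 h0 uV sV.
have sub_cons x (s : seq nat) : {subset x :: s <= V} -> x \in V /\ {subset s <= V}.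
  by move=> h; split=> [|y ys]; apply: h; rewrite inE ?eqxx ?ys ?orbT.
have sub_cat (s t : seq nat) :
    {subset s ++ t <= V} -> {subset s <= V} /\ {subset t <= V}.
  by move=> h; split=> y ys; apply: h; rewrite mem_cat ys ?orbT.
elim=> [x y|x y|p IH|p IHp q IHq|p IHp q IHq|x p IH|x p IH] e e' /=.
- move=> /sub_cons[xV /sub_cons[yV _]] [dom pairs].
  have := dom x xV; have := dom y yV; have := pairs x y xV yV.
  case: (e x) => [u|]; case: (e' x) => [u'|] //.
  case: (e y) => [v|]; case: (e' y) => [v'|] // h _ _.
  by case: (h u v u' v').
- move=> /sub_cons[xV /sub_cons[yV _]] [dom pairs].
  have := dom x xV; have := dom y yV; have := pairs x y xV yV.
  case: (e x) => [u|]; case: (e' x) => [u'|] //.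
  case: (e y) => [v|]; case: (e' y) => [v'|] // h _ _.
  by case: (h u v u' v').
- by move=> sp ag; rewrite (IH e e').
- by move=> /sub_cat[sp sq] ag; rewrite (IHp e e') // (IHq e e').
- by move=> /sub_cat[sp sq] ag; rewrite (IHp e e') // (IHq e e').
- move=> /sub_cons[xV sp] ag; apply/existsP/existsP => -[w].
  + have [w' ag'] := agree_upd w extGH h0 uV sV xV ag.
    by exists w'; rewrite -(IH _ _ sp ag').
  + have [w' /agree_sym ag'] := agree_upd w extHG g0 uV sV xV (agree_sym ag).
    by exists w'; rewrite (IH _ _ sp ag').
- move=> /sub_cons[xV sp] ag; apply/forallP/forallP => h w.
  + have [w' /agree_sym ag'] := agree_upd w extHG g0 uV sV xV (agree_sym ag).
    by rewrite -(IH _ _ sp ag').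
  + have [w' ag'] := agree_upd w extGH h0 uV sV xV ag.
    by rewrite (IH _ _ sp ag').
Qed.

Lemma models_extends (G H : sgraph) (p : formula) :
  extends G H -> extends H G -> inhabited G -> inhabited H ->
  nvars p <= 3 -> (G ⊨ p) = (H ⊨ p).
Proof.
move=> extGH extHG g0 h0 np.
(* The game starts with no pebble placed, where [agree] is trivial. *)
apply: (eval_agree extGH extHG g0 h0 (undup_uniq (vars p)) np) => // y.
by rewrite mem_undup.
Qed.

(** * Rich triangle-free graphs *)

Definition triangle_free (G : sgraph) : Prop :=
  forall u v w : G, adj u v -> ~~ (adj u w && adj v w).

(** For [u = v] this asks for a neighbour of [u] and for a non-neighbour other than [u]. *)
Definition rich (G : sgraph) : Prop :=
  forall (u v : G) (b c : bool), ((u == v) ==> (b == c)) ->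
  (adj u v ==> ~~ (b && c)) ->
  exists w : G, [/\ u != w, v != w, adj u w = b & adj v w = c].

(** A move onto [u] or [v] is copied. Any other [w] has a pattern without triangle, as [G] has none,
    and richness of [H] realizes it over [u'] and [v']. *)
Lemma rich_extends (G H : sgraph) : triangle_free G -> rich H -> extends G H.
Proof.
move=> tfG richH u v u' v' huv w.
case: (eqVneq u w) => [<-|uw].
  by exists u'; split; [exact: same_pair_refl | exact: same_pair_sym].
case: (eqVneq v w) => [<-|vw].
  by exists v'; split; [exact: huv | exact: same_pair_refl].
case: huv => heq hadj.
have [||w' [uw' vw' hu hv]] := richH u' v' (adj u w) (adj v w).
- by rewrite -heq; apply/implyP => /eqP ->.
- by rewrite -hadj; apply/implyP => /tfG.
by exists w'; rewrite /same_pair (negPf uw) (negPf vw) (negPf uw') (negPf vw').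
Qed.

Lemma models_rich (G H : sgraph) (p : formula) :
  triangle_free G -> triangle_free H -> rich G -> rich H ->
  inhabited G -> inhabited H -> nvars p <= 3 -> (G ⊨ p) = (H ⊨ p).
Proof. by move=> *; apply: models_extends => //; exact: rich_extends. Qed.

(** * Graphs given by a list of edges *)

Section EdgeLists.

Variables (n : nat) (E : seq (nat * nat)).

(** Stated on numbers, so that it computes; each edge is listed in one orientation only. *)
Definition edge_rel (i j : nat) : bool := ((i, j) \in E) || ((j, i) \in E).

Hypothesis loopless : all (fun e => e.1 != e.2) E.

Lemma edge_rel_sym : symmetric (fun i j : 'I_n => edge_rel i j).
Proof. by move=> i j; rewrite /edge_rel orbC. Qed.

Lemma edge_rel_irr : irreflexive (fun i j : 'I_n => edge_rel i j).
Proof.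
move=> i; apply/negP; rewrite /edge_rel orbb => /(allP loopless).
by rewrite eqxx.
Qed.

Definition edge_graph : sgraph := SGraph edge_rel_sym edge_rel_irr.

(* Quantifiers over ['I_n] are locked; the tests below range over [iota 0 n]
   so that they can be evaluated by computation. *)
Definition triangle_freeb : bool :=
  let s := iota 0 n in
  all (fun u => all (fun v => edge_rel u v ==>
    all (fun w => ~~ (edge_rel u w && edge_rel v w)) s) s) s.

Definition richb : bool :=
  let s := iota 0 n in
  all (fun u => all (fun v => all (fun b => all (fun c =>
    ((u == v) ==> (b == c)) ==> (edge_rel u v ==> ~~ (b && c)) ==>
    has (fun w => [&& u != w, v != w, edge_rel u w == b & edge_rel v w == c]) s)
    [:: true; false]) [:: true; false]) s) s.

(** Two distinct vertices with two common neighbours are opposite corners of a 4-cycle, so this test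
    excludes all 4-cycles, induced or not. *)
Definition common_neighbour_uniqueb : bool :=
  let s := iota 0 n in
  all (fun u => all (fun v => (u != v) ==>
    all (fun a => edge_rel u a && edge_rel v a ==>
      all (fun b => edge_rel u b && edge_rel v b ==> (a == b)) s) s) s) s.

Lemma ord_iota (i : 'I_n) : (i : nat) \in iota 0 n.
Proof. by rewrite mem_iota /=. Qed.

Lemma triangle_freebP : triangle_freeb -> triangle_free edge_graph.
Proof.
move=> h u v w /= uv; move/allP/(_ _ (ord_iota u)): h.
by move/allP/(_ _ (ord_iota v)); rewrite uv => /allP/(_ _ (ord_iota w)).
Qed.

Lemma richbP : richb -> rich edge_graph.
Proof.
move=> h u v b c hbc huv; move/allP/(_ _ (ord_iota u)): h.
move/allP/(_ _ (ord_iota v))/allP/(_ b) => h.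
have /allP/(_ c) {}h := h (ltac:(by case: (b))).
have := h (ltac:(by case: (c))).
(* The tested premises on numbers are convertible to [hbc] and [huv] on ordinals. *)
rewrite [(_ == _) ==> _]hbc [edge_rel _ _ ==> _]huv /= => /hasP[w].
rewrite mem_iota add0n /= => wn /and4P[uw vw /eqP hu /eqP hv].
by exists (Ordinal wn).
Qed.

Lemma common_neighbour_uniquebP : common_neighbour_uniqueb ->
  forall u v a b : edge_graph, u != v ->
  adj u a -> adj v a -> adj u b -> adj v b -> a = b.
Proof.
move=> h u v a b /= uv ua va ub vb; move/allP/(_ _ (ord_iota u)): h.
move/allP/(_ _ (ord_iota v)); rewrite [_ != _]uv /= => /allP/(_ _ (ord_iota a)).
rewrite ua va /= => /allP/(_ _ (ord_iota b)); rewrite ub vb /= => /eqP.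
exact: val_inj.
Qed.

End EdgeLists.

(** * The Wagner and Petersen graphs *)

Definition wagner_edges : seq (nat * nat) :=
  [:: (0, 1); (1, 2); (2, 3); (3, 4); (4, 5); (5, 6); (6, 7); (7, 0);
      (0, 4); (1, 5); (2, 6); (3, 7)].

Definition wagner : sgraph :=
  @edge_graph 8 wagner_edges (isT : all (fun e => e.1 != e.2) wagner_edges).

(** By rows: the outer pentagon, the spokes, the inner pentagram. *)
Definition petersen_edges : seq (nat * nat) :=
  [:: (0, 1); (1, 2); (2, 3); (3, 4); (4, 0);
      (0, 5); (1, 6); (2, 7); (3, 8); (4, 9);
      (5, 7); (7, 9); (9, 6); (6, 8); (8, 5)].

Definition petersen : sgraph :=
  @edge_graph 10 petersen_edges (isT : all (fun e => e.1 != e.2) petersen_edges).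

Lemma wagner_petersen_equiv (p : formula) :
  nvars p <= 3 -> (wagner ⊨ p) = (petersen ⊨ p).
Proof.
apply: models_rich.
- by apply: triangle_freebP; vm_compute.
- by apply: triangle_freebP; vm_compute.
- by apply: richbP; vm_compute.
- by apply: richbP; vm_compute.
- exact: (inhabits (ord0 : 'I_8)).
- exact: (inhabits (ord0 : 'I_10)).
Qed.

(** * Induced 4-cycles *)

(** Only opposite corners need an explicit inequality, since adjacent vertices are distinct. *)
Lemma induced_C4P (G : sgraph) :
  C4 ⊏ G <-> exists a b c d : G,
    [/\ adj a b, adj b c, adj c d, adj d a &
        [/\ ~~ adj a c, ~~ adj b d, a != c & b != d]].
Proof.
split=> [[f [finj fadj]] | [a [b [c [d [ab bc cd da [ac bd nac nbd]]]]]]].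
  pose o i (hi : i < 4) : C4 := Ordinal hi.
  exists (f (o 0 isT)), (f (o 1 isT)), (f (o 2 isT)), (f (o 3 isT)).
  by rewrite !fadj !(inj_eq finj).
have adj_neq (x y : G) : adj x y -> x != y.
  by apply: contraTneq => ->; rewrite adj_irr.
exists (fun i : 'I_4 => nth a [:: a; b; c; d] i); split.
- move=> i j eq_ij; apply/val_inj/eqP; rewrite /=.
  rewrite -(@nth_uniq _ a [:: a; b; c; d]) ?eq_ij //=.
  by rewrite !inE !negb_or nac nbd (eq_sym a d) !adj_neq.
- have [ba cb dc ad] : [/\ adj b a, adj c b, adj d c & adj a d].
    by split; rewrite adj_sym.
  have [ca db] : ~~ adj c a /\ ~~ adj d b by split; rewrite adj_sym.
  case=> [[|[|[|[|//]]]] i] [[|[|[|[|//]]]] j] /=; rewrite ?adj_irr //;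
    by [ apply: negPf | idtac ].
Qed.

Definition C4_formula : formula :=
  FEx 0 (FEx 1 (FEx 2 (FEx 3
    (FAnd (FAnd (FAnd (FAdj 0 1) (FAdj 1 2)) (FAnd (FAdj 2 3) (FAdj 3 0)))
          (FAnd (FAnd (FNot (FAdj 0 2)) (FNot (FAdj 1 3)))
                (FAnd (FNot (FEq 0 2)) (FNot (FEq 1 3)))))))).

Lemma models_C4_formula (G : sgraph) : G ⊨ C4_formula <-> C4 ⊏ G.
Proof.
rewrite /models /=; split.
  move=> /existsP[a /existsP[b /existsP[c /existsP[d]]]].
  move=> /andP[/andP[/andP[? ?] /andP[? ?]] /andP[/andP[? ?] /andP[? ?]]].
  by apply/induced_C4P; exists a, b, c, d.
move=> /induced_C4P[a [b [c [d [? ? ? ? [? ? ? ?]]]]]].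
apply/existsP; exists a; apply/existsP; exists b.
apply/existsP; exists c; apply/existsP; exists d.
by rewrite /upd /=; do ![apply/andP; split].
Qed.

Lemma C4_in_wagner : C4 ⊏ wagner.
Proof.
pose o i (hi : i < 8) : wagner := Ordinal hi.
(* The rim edges 01 and 45 are joined by the long diagonals 04 and 15. *)
by apply/induced_C4P; exists (o 0 isT), (o 1 isT), (o 5 isT), (o 4 isT).
Qed.

Lemma C4_notin_petersen : ~ C4 ⊏ petersen.
Proof.
move=> /induced_C4P[a [b [c [d [ab bc cd da [_ _ nac /eqP[]]]]]]].
have uniq : common_neighbour_uniqueb 10 petersen_edges by vm_compute.
(* The opposite corners [a] and [c] share the neighbours [b] and [d], which forces [b = d]. *)
by apply: (common_neighbour_uniquebP uniq nac); rewrite // adj_sym.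
Qed.

Lemma wagner_C4_formula : (wagner ⊨ C4_formula) != (petersen ⊨ C4_formula).
Proof.
apply/eqP => eqm; apply: C4_notin_petersen; apply/models_C4_formula.
by rewrite -eqm; apply/models_C4_formula; exact: C4_in_wagner.
Qed.

(** * The two equalities *)

Lemma nvars_wagner_petersen (p : formula) :
  (wagner ⊨ p) != (petersen ⊨ p) -> 3 < nvars p.
Proof. by apply: contraR; rewrite -leqNgt => /wagner_petersen_equiv ->. Qed.

Theorem theorem4p10 : W_eq C4 4 /\ Wstar_eq C4 4.
Proof.
split; split.
- by exists C4_formula; split=> // G; exact: models_C4_formula.
(* A sentence defining containment of [C4] separates the Wagner graph from the Petersen graph. *)
- move=> _ [p [_ <- defp]]; apply: nvars_wagner_petersen.
  apply/eqP => eqm; apply: C4_notin_petersen; apply/defp.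
  by rewrite -eqm; apply/defp; exact: C4_in_wagner.
- exists wagner, petersen; split; [exact: C4_in_wagner | exact: C4_notin_petersen |].
  split=> [|_ [p [_ <- sep]]]; last exact: nvars_wagner_petersen.
  by exists C4_formula; split=> //; exact: wagner_C4_formula.
(* [C4_formula] separates every admissible pair, so no minimum exceeds its four variables. *)
- move=> m [G [H [FG FH [_ minm]]]]; apply: minm; exists C4_formula; split=> //.
  apply/eqP => eqm; apply: FH; apply/models_C4_formula.
  by rewrite -eqm; apply/models_C4_formula.
Qed.
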